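(* Let $U_7^{17}=\{L(C)\in TLeib_7 : c_{2,3}=c_{1,2}=c_{1,1}=0,\ c_{0,1}\neq 0,\ c_{1,4}\neq 0\}$. 1. Two algebras $L(C)$ and $L(C')$ from $U_7^{17}$ are isomorphic if and only if $\left(\frac{c'_{1,3}}{c'_{1,4}}\right)^4c'_{0,1}=\left(\frac{c_{1,3}}{c_{1,4}}\right)^4c_{0,1}$. 2. For any $\lambda\in\mathbb{C}$ there exists $L(C)\in U_7^{17}$ with $\left(\frac{c_{1,3}}{c_{1,4}}\right)^4c_{0,1}=\lambda$. Moreover, the orbits (isomorphism classes) in $U_7^{17}$ are parameterized by the algebras $L(0,1,0,0,\lambda,1,0)$, $\lambda\in\mathbb{C}$: these algebras lie in $U_7^{17}$ and every algebra in $U_7^{17}$ is isomorphic to one of them.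
   Context: All algebras are over $\mathbb{C}$. For $C=(c_{0,0},c_{0,1},c_{1,1},c_{1,2},c_{1,3},c_{1,4},c_{2,3})\in\mathbb{C}^7$, $L(C)$ denotes the $7$-dimensional complex (Leibniz) algebra with basis $e_0,e_1,\dots,e_6$ and products (products of basis vectors not listed are zero): $[e_i,e_0]=e_{i+1}$ for $1\le i\le 5$; $[e_0,e_i]=-e_{i+1}$ for $2\le i\le 5$; $[e_0,e_0]=c_{0,0}e_6$; $[e_0,e_1]=-e_2+c_{0,1}e_6$; $[e_1,e_1]=c_{1,1}e_6$; $[e_1,e_2]=-[e_2,e_1]=c_{1,2}e_4+c_{1,3}e_5+c_{1,4}e_6$; $[e_1,e_3]=-[e_3,e_1]=c_{1,2}e_5+c_{1,3}e_6$; $[e_1,e_4]=-[e_4,e_1]=(c_{1,2}-c_{2,3})e_6$; $[e_2,e_3]=-[e_3,e_2]=c_{2,3}e_6$. $TLeib_7$ is the set of all $L(C)$, $C\in\mathbb{C}^7$. The entries of $C'$ are denoted $c'_{i,j}$, in the same order. ''Isomorphic'' means isomorphic as algebras over $\mathbb{C}$; an orbit is an isomorphism class. *)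

(* Defs.v *)
From HB Require Import structures.
From mathcomp Require Import all_boot all_order all_algebra.
From mathcomp Require Export reals complex.

Set Implicit Arguments.
Unset Strict Implicit.
Unset Printing Implicit Defensive.

Import GRing.Theory.
Local Open Scope ring_scope.

(* Not necessarily associative, not necessarily unital algebras. *)
Record naAlgebra (K : fieldType) := NaAlgebra {
  carrier :> lmodType K;
  bracket : {bilinear carrier -> carrier -> carrier}
}.

Definition alg_isomorphic (K : fieldType) (A B : naAlgebra K) : Prop :=
  exists f : {linear A -> B},
    bijective f /\ forall x y : A, f (bracket A x y) = bracket B (f x) (f y).

Record param (K : fieldType) := Param {
  c00 : K; c01 : K; c11 : K; c12 : K; c13 : K; c14 : K; c23 : K
}.

Definition e7 (K : fieldType) (k : nat) : 'rV[K]_7 := delta_mx 0 (inord k).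

Definition basis_bracket (K : fieldType) (C : param K) (i j : nat) : 'rV[K]_7 :=
  match i, j with
  | 0%N, 0%N => c00 C *: e7 K 6
  | 0%N, 1%N => - e7 K 2 + c01 C *: e7 K 6
  | 0%N, (2 | 3 | 4 | 5)%N => - e7 K j.+1
  | (1 | 2 | 3 | 4 | 5)%N, 0%N => e7 K i.+1
  | 1%N, 1%N => c11 C *: e7 K 6
  | 1%N, 2%N => c12 C *: e7 K 4 + c13 C *: e7 K 5 + c14 C *: e7 K 6
  | 2%N, 1%N => - (c12 C *: e7 K 4 + c13 C *: e7 K 5 + c14 C *: e7 K 6)
  | 1%N, 3%N => c12 C *: e7 K 5 + c13 C *: e7 K 6
  | 3%N, 1%N => - (c12 C *: e7 K 5 + c13 C *: e7 K 6)
  | 1%N, 4%N => (c12 C - c23 C) *: e7 K 6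
  | 4%N, 1%N => - ((c12 C - c23 C) *: e7 K 6)
  | 2%N, 3%N => c23 C *: e7 K 6
  | 3%N, 2%N => - (c23 C *: e7 K 6)
  | _, _ => 0
  end.

Definition tleib_bracket (K : fieldType) (C : param K) (x y : 'rV[K]_7) :
    'rV[K]_7 :=
  \sum_(i < 7) \sum_(j < 7) (x 0 i * y 0 j) *: basis_bracket C i j.

Lemma tleib_bracket_bilinear (K : fieldType) (C : param K) :
  bilinear_for *:%R *:%R (@tleib_bracket K C).
Proof.
split=> [y a x x'|x a y y'] /=; rewrite /tleib_bracket scaler_sumr -big_split /=;
  apply: eq_bigr => i _; rewrite scaler_sumr -big_split /=; apply: eq_bigr => j _;
  rewrite !mxE scalerA -scalerDl.
- by rewrite mulrDl mulrA.
- by rewrite mulrDr mulrCA.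
Qed.

HB.instance Definition _ (K : fieldType) (C : param K) :=
  bilinear_isBilinear.Build K 'rV[K]_7 'rV[K]_7 'rV[K]_7 *:%R *:%R
    (@tleib_bracket K C) (@tleib_bracket_bilinear K C).

(* The family TLeib_7 is the range of [L]. *)
Definition L (K : fieldType) (C : param K) : naAlgebra K :=
  @NaAlgebra K 'rV[K]_7 (@tleib_bracket K C).

(* [L C] belongs to U_7^17: the conditions bear on the structure constants [C],
   so the subset is given by its parameters. *)
Definition in_U717 (K : fieldType) (C : param K) : Prop :=
  [/\ c23 C = 0, c12 C = 0, c11 C = 0, c01 C != 0 & c14 C != 0].

(* Main.v *)
Require Import Defs.
From HB Require Import structures.
From mathcomp Require Import all_boot all_order all_algebra.
From mathcomp Require Import ring.

(** Write b, p, q for c01, c13, c14 and b', p', q' for the primed constants.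
    The whole classification rests on one criterion, valid over every field:
    L(C) and L(C') in U_7^17 are isomorphic if and only if there are nonzero
    scalars s, v with

      p' v = p s^3,   q' v = q s^4,   b' = b s^4   ([isomorphic_scaling]).

    L(C) is generated by e_0 and e_1, with e_(i+1) = [e_i, e_0], so an
    isomorphism f is determined by f(e_0) and f(e_1). Let s be the e_0
    coordinate of f(e_0) and v the e_1 coordinate of f(e_1). The product
    [e_1, e_2] = p e_5 + q e_6 lies deep in the lower central series; this
    forces f(e_1) to have no e_0 coordinate, and then comparing e_5 and e_6
    coordinates in f[e_1, e_2] and f[e_0, e_1] gives the three relations
    ([isomorphic_scaling_of]). Conversely the relations are all that the linear
    map extending e_0 |-> s e_0 + t e_1, e_1 |-> v e_1 needs to be a morphism,
    apart from a condition on c00, and this one is met by a suitable t because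
    b is nonzero ([adapted_alg_isomorphic]).

    From the relations, p'/q' = (p/q)/s and b' = b s^4, so (p/q)^4 b is
    invariant. If the invariants agree, then s := (p q')/(p' q) works when p is
    nonzero; when p = 0 also p' = 0, and any fourth root of b'/b will do. The
    scalar v is then read off from q' v = q s^4. Since L(0,1,0,0,x,1,0) has
    invariant x^4, fourth roots also show that these algebras meet every
    isomorphism class of U_7^17. *)

Import GRing.Theory Num.Theory.
Local Open Scope ring_scope.

Local Notation "x :[ k ]" := (x 0 (inord k : 'I_7))
  (at level 2, left associativity, format "x :[ k ]").
Local Notation minor x y i j := (x:[i] * y:[j] - x:[j] * y:[i]).

(** * Coordinates of the bracket *)

Section Coordinates.
Variables (K : fieldType) (C : param K).
Implicit Types x y : 'rV[K]_7.

Lemma row7P x y : (forall k, (k < 7)%N -> x:[k] = y:[k]) -> x = y.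
Proof. by move=> xy; apply/rowP => i; rewrite -(inord_val i); apply: xy. Qed.

Lemma e7E j k : (j < 7)%N -> (k < 7)%N -> (e7 K j):[k] = (k == j)%:R.
Proof. by move=> lt_j lt_k; rewrite mxE eqxx -val_eqE /= !inordK. Qed.

(** Unlike [mxE], these rules leave the basis vectors [e7 K j] folded, so that
    their coordinates can be treated as atoms. *)
Lemma coordE k :
  ((forall x y, (x + y)%R:[k] = (x:[k] + y:[k])%R)
  * (forall x, (- x)%R:[k] = - x:[k])
  * (forall a x, (a *: x)%R:[k] = (a * x:[k])%R)
  * ((0 : 'rV[K]_7):[k] = 0))%type.
Proof. by do !split=> *; rewrite mxE. Qed.

Lemma sum7E (V : nmodType) (F : 'I_7 -> V) :
  \sum_i F i = F (inord 0) + F (inord 1) + F (inord 2) + F (inord 3)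
             + F (inord 4) + F (inord 5) + F (inord 6).
Proof.
rewrite !big_ord_recr big_ord0 /= add0r.
by do !congr (_ + _); congr F; apply/val_inj; rewrite /= inordK.
Qed.

Lemma tleib_bracket_e7 i j : (i < 7)%N -> (j < 7)%N ->
  tleib_bracket C (e7 K i) (e7 K j) = basis_bracket C i j.
Proof.
move=> lt_i lt_j; rewrite /tleib_bracket (bigD1 (inord i)) //=.
rewrite [X in _ + X]big1 => [|k ki].
  rewrite addr0 (bigD1 (inord j)) //= [X in _ + X]big1 => [|k kj].
    by rewrite !mxE !eqxx !inordK // mulr1 scale1r addr0.
  by rewrite [X in _ * X]mxE (negPf kj) andbF mulr0 scale0r.
by rewrite big1 // => l _; rewrite mxE (negPf ki) andbF mul0r scale0r.
Qed.

(** All products but those of pairs in the span of [e_0] and [e_1] are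
    antisymmetric, whence the 2 x 2 minors. *)
Lemma tleib_bracket_expand x y : tleib_bracket C x y =
  minor x y 1 0 *: e7 K 2 + minor x y 2 0 *: e7 K 3
  + (minor x y 3 0 + c12 C * minor x y 1 2) *: e7 K 4
  + (minor x y 4 0 + c12 C * minor x y 1 3 + c13 C * minor x y 1 2) *: e7 K 5
  + (minor x y 5 0 + c00 C * (x:[0] * y:[0]) + c01 C * (x:[0] * y:[1])
     + c11 C * (x:[1] * y:[1]) + c14 C * minor x y 1 2 + c13 C * minor x y 1 3
     + (c12 C - c23 C) * minor x y 1 4 + c23 C * minor x y 2 3) *: e7 K 6.
Proof.
apply: row7P => k _.
have -> : (tleib_bracket C x y):[k] =
    \sum_(i < 7) \sum_(j < 7) x 0 i * y 0 j * (basis_bracket C i j):[k].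
  rewrite summxE; apply: eq_bigr => i _; rewrite summxE.
  by apply: eq_bigr => j _; rewrite mxE.
rewrite sum7E !sum7E !inordK //= !coordE; ring.
Qed.

Lemma U717_bracketE (CU : in_U717 C) x y : let z := tleib_bracket C x y in
  (((z:[0] = 0) * (z:[1] = 0)) *
  ((z:[2] = minor x y 1 0)%R * (z:[3] = minor x y 2 0)%R) *
  (z:[4] = minor x y 3 0)%R *
  (z:[5] = minor x y 4 0 + c13 C * minor x y 1 2)%R *
  (z:[6] = minor x y 5 0 + c00 C * (x:[0] * y:[0]) + c01 C * (x:[0] * y:[1])
     + c14 C * minor x y 1 2 + c13 C * minor x y 1 3)%R)%type.
Proof.
have [c23_0 c12_0 c11_0 _ _] := CU.
rewrite /= tleib_bracket_expand c23_0 c12_0 c11_0.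
by do ![split]; rewrite !coordE !e7E //=; ring.
Qed.

End Coordinates.
Arguments U717_bracketE {K C} CU x y.

(** * Adapted changes of basis *)

Section AdaptedMap.
Variables (K : fieldType) (C C' : param K) (s t v : K).
Implicit Types x y : 'rV[K]_7.

(** The linear map sending [e_0] to [u := s e_0 + t e_1], [e_1] to [v e_1], and
    then [e_(i+1)] to the bracket in [L C'] of the image of [e_i] with [u]; these
    iterated brackets have been computed for [C'] in U_7^17. *)
Definition adapted_map x : 'rV[K]_7 := \row_k
  [:: s * x:[0]; t * x:[0] + v * x:[1]; s * v * x:[2]; s ^+ 2 * v * x:[3];
      s ^+ 3 * v * x:[4];
      s ^+ 4 * v * x:[5] - s * t * v * c13 C' * x:[3];
      s ^+ 5 * v * x:[6] - s * t * v * c14 C' * x:[3]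
        - s ^+ 2 * t * v * c13 C' * x:[4] *+ 2]`_k.

Definition adapted_map_inv y : 'rV[K]_7 := \row_k
  [:: y:[0] / s; (y:[1] - t * y:[0] / s) / v; y:[2] / (s * v);
      y:[3] / (s ^+ 2 * v); y:[4] / (s ^+ 3 * v);
      (y:[5] + t * c13 C' * y:[3] / s) / (s ^+ 4 * v);
      (y:[6] + t * c14 C' * y:[3] / s + t * c13 C' * y:[4] / s *+ 2)
        / (s ^+ 5 * v)]`_k.

Lemma adapted_map_linear : linear adapted_map.
Proof.
move=> a x y; apply: row7P => k lt_k; rewrite !coordE !mxE inordK //.
by do 7?[case: k lt_k => [|k] lt_k //=]; ring.
Qed.

HB.instance Definition _ :=
  GRing.isLinear.Build K 'rV[K]_7 'rV[K]_7 _ adapted_map adapted_map_linear.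

Hypotheses (s_neq0 : s != 0) (v_neq0 : v != 0).

Lemma adapted_map_bij : bijective adapted_map.
Proof.
exists adapted_map_inv => x; apply: row7P => k lt_k; rewrite !mxE inordK //.
all: by do 7?[case: k lt_k => [|k] lt_k //=]; rewrite ?mxE ?inordK //=; field;
  rewrite ?s_neq0 ?v_neq0.
Qed.

Hypotheses (CU : in_U717 C) (CU' : in_U717 C').
Hypotheses (c13E : c13 C' = c13 C * s ^+ 3 / v).
Hypotheses (c14E : c14 C' = c14 C * s ^+ 4 / v).
Hypotheses (c01E : c01 C' = c01 C * s ^+ 4).
Hypotheses (c00E : c00 C' = (c00 C * v - c01 C * t) * s ^+ 3).

Lemma adapted_map_bracket x y :
  adapted_map (tleib_bracket C x y) =
  tleib_bracket C' (adapted_map x) (adapted_map y).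
Proof.
apply: row7P => k lt_k; rewrite [in LHS]mxE inordK //.
do 7?[case: k lt_k => [|k] lt_k //=];
  rewrite !(U717_bracketE CU, U717_bracketE CU');
  rewrite ?mxE ?inordK //= ?c13E ?c14E ?c01E ?c00E; field;
  rewrite ?s_neq0 ?v_neq0 //.
Qed.

Lemma adapted_alg_isomorphic : alg_isomorphic (L C) (L C').
Proof.
exists (adapted_map : {linear 'rV[K]_7 -> 'rV[K]_7}).
by split; [apply: adapted_map_bij | apply: adapted_map_bracket].
Qed.

End AdaptedMap.

(** * The isomorphism criterion *)

Section Criterion.
Variables (K : fieldType) (C C' : param K).
Hypotheses (CU : in_U717 C) (CU' : in_U717 C').

(** Let [w k] be the image of [e_k]. Bracketing with [w 0] on the right moves
    coordinates one place up and multiplies them by [s], up to terms that vanish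
    on the coordinates followed here; so the leading coordinates of the [w k]
    form a geometric progression starting at the minor [D] of [w 1] and [w 0],
    and [D] and [s] are nonzero since [w 6] is. *)
Lemma isomorphic_scaling_of : alg_isomorphic (L C) (L C') ->
  exists s v : K, [/\ s != 0, v != 0, c13 C' * v = c13 C * s ^+ 3,
                    c14 C' * v = c14 C * s ^+ 4 & c01 C' = c01 C * s ^+ 4].
Proof.
case=> f [/bij_inj f_inj f_hom].
have {}f_hom i j : (i < 7)%N -> (j < 7)%N -> f (basis_bracket C i j) =
    tleib_bracket C' (f (e7 K i)) (f (e7 K j)).
  by move=> lt_i lt_j; rewrite -tleib_bracket_e7 //; apply: f_hom.
have [_ c12_0 _ _ _] := CU.
pose w k : 'rV[K]_7 := f (e7 K k).
have wS k : (0 < k < 6)%N -> w k.+1 = tleib_bracket C' (w k) (w 0%N).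
  by case: k => [|[|[|[|[|[]]]]]] // _; rewrite /w -f_hom.
have w6_neq0 : w 6%N != 0.
  rewrite /w -(raddf0 f) (inj_eq f_inj); apply/eqP => /rowP/(_ (inord 6)).
  by rewrite e7E // mxE => /eqP; rewrite oner_eq0.
have w12 : tleib_bracket C' (w 1%N) (w 2%N) = c13 C *: w 5%N + c14 C *: w 6%N.
  by rewrite -f_hom //= c12_0 scale0r add0r linearD !linearZ.
have w01 : tleib_bracket C' (w 0%N) (w 1%N) = c01 C *: w 6%N - w 2%N.
  by rewrite -f_hom //= addrC linearB linearZ.
pose s := (w 0%N):[0]; pose v := (w 1%N):[1].
have E := U717_bracketE CU'.
pose D := minor (w 1%N) (w 0%N) 1 0.
have w2E : (((w 2%N):[0] = 0) * ((w 2%N):[1] = 0) * ((w 2%N):[2] = D))%type.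
  by rewrite wS ?E.
have w3E : (((w 3%N):[0] = 0) * ((w 3%N):[1] = 0) * ((w 3%N):[2] = 0)
  * ((w 3%N):[3] = D * s)%R)%type.
  by rewrite (wS 2%N) ?E ?w2E -/s; do !split; ring.
have w4E : (((w 4%N):[0] = 0) * ((w 4%N):[1] = 0) * ((w 4%N):[2] = 0)
  * ((w 4%N):[3] = 0) * ((w 4%N):[4] = D * s ^+ 2)%R)%type.
  by rewrite (wS 3%N) ?E ?w3E -/s; do !split; ring.
have w5E : (((w 5%N):[0] = 0) * ((w 5%N):[1] = 0) * ((w 5%N):[2] = 0)
  * ((w 5%N):[3] = 0) * ((w 5%N):[4] = 0) * ((w 5%N):[5] = D * s ^+ 3)%R)%type.
  by rewrite (wS 4%N) ?E ?w4E -/s; do !split; ring.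
have w6E : w 6%N = (D * s ^+ 4) *: e7 K 6.
  apply: row7P => k lt_k; rewrite coordE e7E // (wS 5%N) //.
  by do 7?[case: k lt_k => [|k] lt_k //=]; rewrite E ?w5E -/s; ring.
have : D * s ^+ 4 != 0.
  by apply: contraNneq w6_neq0 => D0; rewrite w6E D0 scale0r.
rewrite mulf_eq0 negb_or expf_eq0 /= => /andP[D_neq0 s_neq0].
have w6_6 : (w 6%N):[6] = D * s ^+ 4 by rewrite w6E coordE e7E //= mulr1.
have w6_lt6 k : (k < 6)%N -> (w 6%N):[k] = 0.
  by move=> lt_k; rewrite w6E coordE e7E ?(ltn_trans lt_k) // ltn_eqF // mulr0.
(* The image of [e_1, e_2] has no e_3 coordinate. *)
have v0_eq0 : (w 1%N):[0] = 0.
  have := congr1 (fun z : 'rV_7 => z:[3]) w12.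
  rewrite E !coordE !w2E w5E w6_lt6 // !mulr0 addr0 sub0r => /eqP.
  by rewrite oppr_eq0 mulf_eq0 (negPf D_neq0) orbF => /eqP.
have DE : D = v * s by rewrite /D v0_eq0 mul0r subr0.
have v_neq0 : v != 0 by apply: contraNneq D_neq0 => v0; rewrite DE v0 mul0r.
have p'E : c13 C' * v = c13 C * s ^+ 3.
  have := congr1 (fun z : 'rV_7 => z:[5]) w12.
  rewrite E !coordE !w2E w5E w6_lt6 // v0_eq0 -/v => /eqP.
  rewrite -subr_eq0 => /eqP eq5; apply/(mulIf D_neq0)/subr0_eq.
  by rewrite -[RHS]eq5; ring.
(* The next-to-leading coordinates of w 2, ..., w 5 are again geometric. They
   enter both sides of the e_6 coordinate of w12, and cancel by the relation
   just found. *)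
have w3_4 : (w 3%N):[4] = (w 2%N):[3] * s.
  by rewrite (wS 2%N) ?E ?w2E -/s //; ring.
have w4_5 : (w 4%N):[5] = (w 2%N):[3] * s ^+ 2.
  by rewrite (wS 3%N) ?E ?w3E ?w3_4 -/s //; ring.
have w5_6 : (w 5%N):[6] = (w 2%N):[3] * s ^+ 3.
  by rewrite (wS 4%N) ?E ?w4E ?w4_5 -/s //; ring.
have q'E : c14 C' * v = c14 C * s ^+ 4.
  have := congr1 (fun z : 'rV_7 => z:[6]) w12.
  rewrite E !coordE !w2E w5_6 w6_6 // v0_eq0 -/v => /eqP.
  rewrite -subr_eq0 => /eqP eq6; apply/(mulIf D_neq0)/subr0_eq.
  have p'_eq : c13 C' = c13 C * s ^+ 3 / v by rewrite -p'E mulfK.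
  by rewrite -[RHS]eq6 p'_eq; field.
have b'E : c01 C' = c01 C * s ^+ 4.
  have := congr1 (fun z : 'rV_7 => z:[6]) w01.
  rewrite !coordE w6_6 (wS 1%N) // !E v0_eq0 -/v -/s DE => /eqP.
  rewrite -subr_eq0 => /eqP eq6.
  by apply/(mulIf (mulf_neq0 v_neq0 s_neq0))/subr0_eq; rewrite -[RHS]eq6; ring.
by exists s, v.
Qed.

Lemma isomorphic_scaling : alg_isomorphic (L C) (L C') <->
  exists s v : K, [/\ s != 0, v != 0, c13 C' * v = c13 C * s ^+ 3,
                    c14 C' * v = c14 C * s ^+ 4 & c01 C' = c01 C * s ^+ 4].
Proof.
split; first exact: isomorphic_scaling_of.
case=> s [v [s_neq0 v_neq0 p'E q'E b'E]]; have [_ _ _ b_neq0 _] := CU.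
(* The solution t of c00 C' = (c00 C * v - c01 C * t) * s ^+ 3. *)
pose t := (c00 C * v * s ^+ 3 - c00 C') / (c01 C * s ^+ 3).
apply: (@adapted_alg_isomorphic _ _ _ s t v) => //.
- by rewrite -p'E mulfK.
- by rewrite -q'E mulfK.
- by rewrite /t; field; rewrite s_neq0 b_neq0.
Qed.

End Criterion.

(** * The invariant *)

Lemma U717_isomorphic_iff (K : numClosedFieldType) (C C' : param K) :
  in_U717 C -> in_U717 C' ->
  (alg_isomorphic (L C) (L C') <->
   (c13 C' / c14 C') ^+ 4 * c01 C' = (c13 C / c14 C) ^+ 4 * c01 C).
Proof.
move=> CU CU'; rewrite isomorphic_scaling //.
have [_ _ _ b_neq0 q_neq0] := CU; have [_ _ _ b'_neq0 q'_neq0] := CU'.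
split=> [[s [v [s_neq0 v_neq0 p'E q'E b'E]]] | invE].
  have -> : c13 C' / c14 C' = c13 C / c14 C / s.
    rewrite -(mulfK v_neq0 (c13 C')) -(mulfK v_neq0 (c14 C')) p'E q'E.
    by field; rewrite s_neq0 v_neq0 q_neq0.
  by rewrite b'E; field; rewrite s_neq0 q_neq0.
(* The second equation is what remains of the first two relations once v is
   eliminated between them. *)
have [s [b'E p'E]] : exists s, c01 C' = c01 C * s ^+ 4 /\
    c13 C' * c14 C * s = c13 C * c14 C'.
  have [p0 | p_neq0] := eqVneq (c13 C) 0.
    exists (4.-root (c01 C' / c01 C)).
    rewrite rootCK // mulrC divfK //; split=> //.
    move/eqP: invE; rewrite p0 !mul0r expr0n mul0r mulf_eq0 (negPf b'_neq0).
    rewrite orbF expf_eq0 /= mulf_eq0 invr_eq0 (negPf q'_neq0) orbF.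
    by move/eqP->; rewrite !mul0r.
  have p'_neq0 : c13 C' != 0.
    apply: contraTneq p_neq0 => p'0; move/esym/eqP: invE.
    rewrite p'0 !mul0r expr0n mul0r mulf_eq0 (negPf b_neq0) orbF.
    by rewrite expf_eq0 /= mulf_eq0 invr_eq0 (negPf q_neq0) orbF negbK.
  exists ((c13 C * c14 C') / (c13 C' * c14 C)); split; last first.
    by field; rewrite p'_neq0 q_neq0.
  have nz : (c13 C' / c14 C') ^+ 4 != 0.
    by rewrite expf_neq0 // mulf_neq0 ?invr_eq0.
  by apply: (mulfI nz); rewrite invE; field; rewrite p'_neq0 q_neq0 q'_neq0.
have s_neq0 : s != 0.
  by apply: contraNneq b'_neq0 => s0; rewrite b'E s0 expr0n mulr0.
exists s, (c14 C * s ^+ 4 / c14 C'); split=> //.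
- by rewrite !mulf_neq0 ?invr_eq0 ?expf_neq0.
- have -> : c13 C' = c13 C * c14 C' / (c14 C * s).
    by rewrite -p'E; field; rewrite s_neq0 q_neq0.
  by field; rewrite s_neq0 q_neq0 q'_neq0.
- by field; rewrite q'_neq0.
Qed.

Theorem proposition2p11 (R : realType) :
  [/\ forall C C' : param R[i], in_U717 C -> in_U717 C' ->
        (alg_isomorphic (L C) (L C') <->
         (c13 C' / c14 C') ^+ 4 * c01 C' = (c13 C / c14 C) ^+ 4 * c01 C),
      forall lambda : R[i], exists C : param R[i],
        in_U717 C /\ (c13 C / c14 C) ^+ 4 * c01 C = lambda,
      forall lambda : R[i], in_U717 (Param 0 1 0 0 lambda 1 0)
    & forall C : param R[i], in_U717 C ->
        exists lambda : R[i],
          alg_isomorphic (L C) (L (Param 0 1 0 0 lambda 1 0))].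
Proof.
have normalU (lambda : R[i]) : in_U717 (Param 0 1 0 0 lambda 1 0).
  by split=> //=; apply: oner_neq0.
have [root4 root4K] : exists r : R[i] -> R[i], forall z, r z ^+ 4 = z.
  by exists (fun z => 4.-root z) => z; rewrite rootCK.
have normal_inv (lambda : R[i]) :
    let C := Param 0 1 0 0 (root4 lambda) 1 0 in
    (c13 C / c14 C) ^+ 4 * c01 C = lambda.
  by rewrite /= divr1 mulr1.
split=> //.
- exact: U717_isomorphic_iff.
- move=> lambda; exists (Param 0 1 0 0 (root4 lambda) 1 0).
  by split; [apply: normalU | apply: normal_inv].
- move=> C CU; exists (root4 ((c13 C / c14 C) ^+ 4 * c01 C)).
  by apply/U717_isomorphic_iff => //; rewrite normal_inv.
Qed.
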